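(* Let $G \in \mathcal{C}$. Then $G$ is a $4$-$\chi_\rho$-critical graph if and only if $G$ is one of the following graphs: (1) $G \cong C_n$ with $n \geq 5$ and $n \not\equiv 0 \pmod 4$; (2) $G$ is the net graph; (3) $G$ is obtained by attaching a single leaf to each of two adjacent vertices of $C_4$.
   Context: Graphs are finite and simple. $\mathcal{C}$ is the class of graphs that contain exactly one cycle and are obtained from a cycle by attaching an arbitrary number (possibly zero) of leaves (pendant vertices of degree 1) to each vertex of the cycle. The net graph is obtained by attaching a single leaf to each vertex of $C_3$. A $k$-packing coloring of $G$ is a map $c:V(G)\to\{1,\ldots,k\}$ such that two distinct vertices $u,v$ with $c(u)=c(v)=i$ satisfy $d_G(u,v)>i$ (distance between vertices in different components is infinite); $\chi_\rho(G)$ is the smallest $k$ for which such a coloring exists. $G$ is $4$-$\chi_\rho$-critical if $\chi_\rho(G)=4$ and $\chi_\rho(H)<\chi_\rho(G)$ for every proper subgraph $H$ of $G$. *)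

(* Defs.v *)
(* Simple graphs are symmetric irreflexive relations on a finType. *)
From mathcomp Require Import all_boot.
Set Implicit Arguments. Unset Strict Implicit. Unset Printing Implicit Defensive.

(* A (sub)graph is given by a vertex set V and an edge relation E
   (with edges only between vertices of V). *)

(* reach_le E k u v : there is a walk of length at most k from u to v using E,
   i.e. d(u,v) <= k (u, v in V, E inside V). *)
Fixpoint reach_le (T : finType) (E : rel T) (k : nat) (u v : T) : bool :=
  match k with
  | 0 => u == v
  | k'.+1 => reach_le E k' u v || [exists w, reach_le E k' u w && E w v]
  end.

Definition packing_coloring (T : finType) (V : {set T}) (E : rel T)
  (k : nat) (c : T -> nat) : Prop :=
  (forall u, u \in V -> 1 <= c u <= k) /\
  (forall u v, u \in V -> v \in V -> u != v -> c u = c v ->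
     ~~ reach_le E (c u) u v).

Definition packable (T : finType) (V : {set T}) (E : rel T) (k : nat) : Prop :=
  exists c : T -> nat, packing_coloring V E k c.

Definition pchi (T : finType) (V : {set T}) (E : rel T) (k : nat) : Prop :=
  packable V E k /\ forall j, j < k -> ~ packable V E j.

Definition is_subgraph (T : finType) (e : rel T) (V : {set T}) (E : rel T) : Prop :=
  symmetric E /\ (forall x y, E x y -> [/\ e x y, x \in V & y \in V]).

Definition is_proper_subgraph (T : finType) (e : rel T) (V : {set T}) (E : rel T)
  : Prop :=
  is_subgraph e V E /\ (V != setT \/ exists x y, e x y && ~~ E x y).

Definition critical4 (T : finType) (e : rel T) : Prop :=
  pchi setT e 4 /\
  forall (V : {set T}) (E : rel T), is_proper_subgraph e V E ->
    exists k, k < 4 /\ pchi V E k.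

(* Class C: a cycle s (length >= 3, distinct vertices, no chords) with
   pendant leaves attached to cycle vertices. *)
Definition in_class_C (T : finType) (e : rel T) : Prop :=
  exists s : seq T,
    [/\ 3 <= size s, uniq s, cycle e s &
        (forall x y, x \in s -> y \in s -> e x y -> y = next s x \/ x = next s y)] /\
        (forall x y, x \notin s -> y \notin s -> ~~ e x y) /\
        (forall x, x \notin s -> #|[set y | e x y]| = 1).

Definition isomorphic (T : finType) (e : rel T) (T' : finType) (e' : rel T') : Prop :=
  exists f : T -> T', bijective f /\ forall x y, e' (f x) (f y) = e x y.

Definition cycle_graph (n : nat) : rel 'I_n :=
  fun i j => (j == (i.+1 %% n) :> nat) || (i == (j.+1 %% n) :> nat).

Definition graph_of_edges (n : nat) (es : seq (nat * nat)) : rel 'I_n :=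
  fun i j => ((i : nat, j : nat) \in es) || ((j : nat, i : nat) \in es).

Definition net_graph : rel 'I_6 :=
  @graph_of_edges 6 [:: (0,1); (1,2); (2,0); (3,0); (4,1); (5,2)].

Definition c4_two_leaves : rel 'I_6 :=
  @graph_of_edges 6 [:: (0,1); (1,2); (2,3); (3,0); (4,0); (5,1)].

(* Main.v *)
Require Import Defs.
From mathcomp Require Import all_boot zify.
From Stdlib Require Import Classical.

Set Implicit Arguments. Unset Strict Implicit. Unset Printing Implicit Defensive.

(* In a 3-packing coloring a vertex of degree at least 3 is never coloured 1,
   and along a walk with two spare vertices at either end the colour 1 occurs at
   exactly every other vertex. Hence a cycle of length n >= 4 is 3-packable only
   if 4 divides n, and two leaves at odd distance along the cycle obstruct
   3-packability, for n >= 8 even after cutting the cycle far from both.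
   Conversely the periodic pattern 1, 2, 1, 3 colours paths, cycles of length
   divisible by 4, and such cycles with all leaves at positions of one parity. *)

(** The forward direction is a squeeze: a critical graph has no proper subgraph that resists three
    colours, so an obstruction located inside it must be the whole graph. The two sporadic graphs
    arise where the alternation of colour 1 has no room. It needs four distinct consecutive
    vertices, which a triangle lacks. Two leaves at odd distance m, together with the spare
    vertices, occupy m + 5 cycle vertices. On C_4 these do not fit, no edge can be spared, and a
    direct argument replaces the walk; for larger n divisible by 4 they fit, measured along the
    shorter arc, so such a graph is never critical. *)

Section Packing.

Variables (T : finType).
Implicit Types (V : {set T}) (E : rel T) (c : T -> nat).

(** * Packability, subgraphs and criticality *)

Lemma packable_mono V E j k : j <= k -> packable V E j -> packable V E k.
Proof.
move=> jk [c [c1 c2]]; exists c; split=> // u uV.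
by have /andP[-> /leq_trans->] := c1 _ uV.
Qed.

Lemma pchi_exists V E : packable V E 3 -> exists k, k < 4 /\ pchi V E k.
Proof.
move=> P3.
have [P0|N0] := classic (packable V E 0); first by exists 0; do !split.
have [P1|N1] := classic (packable V E 1).
  by exists 1; do !split=> //; case.
have [P2|N2] := classic (packable V E 2).
  by exists 2; do !split=> //; case=> [|[]].
by exists 3; do !split=> //; case=> [|[|[]]].
Qed.

Lemma reach_hom (T' : finType) (f : T -> T') E (E' : rel T') k u v :
  (forall x y, E x y -> E' (f x) (f y)) ->
  reach_le E k u v -> reach_le E' k (f u) (f v).
Proof.
move=> hom; elim: k v => [|k IHk] v /=; first by move/eqP->.
case/orP=> [/IHk->//|/existsP[w /andP[/IHk uw /hom wv]]].
by apply/orP; right; apply/existsP; exists (f w); rewrite uw.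
Qed.

(** Homomorphisms do not increase distances, so a colouring pulls back along them. The case
    [f := id] handles subgraphs on the same vertex type. *)
Lemma packable_hom (T' : finType) (f : T -> T') V E (V' : {set T'}) (E' : rel T') k :
  {in V, forall x, f x \in V'} -> {in V &, injective f} ->
  (forall x y, E x y -> E' (f x) (f y)) ->
  packable V' E' k -> packable V E k.
Proof.
move=> fV finj hom [c [c1 c2]]; exists (c \o f); split=> [u /fV/c1//|u v uV vV uv cuv].
apply/negP=> /(reach_hom hom); apply/negP; apply: c2; rewrite ?fV //.
by apply: contra_neq uv => /finj; apply.
Qed.

Definition del_edge E x y : rel T :=
  fun u v => [&& E u v, (u, v) != (x, y) & (u, v) != (y, x)].

Lemma del_edge_sym E x y : symmetric E -> symmetric (del_edge E x y).
Proof.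
move=> Es u v; rewrite /del_edge Es !xpair_eqE.
by rewrite [(v == x) && _]andbC [(v == y) && _]andbC; congr (_ && _); rewrite andbC.
Qed.

(** A missing vertex takes an incident edge with it, as none is isolated; thus every proper subgraph
    lies inside some [del_edge]. *)
Lemma critical4I E : symmetric E -> (forall x, exists y, E x y) ->
  packable setT E 4 -> ~ packable setT E 3 ->
  (forall x y, E x y -> packable setT (del_edge E x y) 3) -> critical4 E.
Proof.
move=> Es noiso P4 N3 Pdel; split.
  by split=> // j j3 /(packable_mono (j3 : j <= 3)).
move=> V E' [[E's sub] prop]; apply: pchi_exists.
have [x [y /andP[xy nxy]]] : exists x y, E x y && ~~ E' x y.
  case: prop => // /eqP VT.
  have [x xV] : exists x, x \notin V.
    apply/existsP; rewrite -negb_forall; apply/negP=> /forallP h.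
    by apply: VT; apply/setP=> z; rewrite h inE.
  have [y xy] := noiso x; exists x, y; rewrite xy /=.
  by apply: contraNN xV => /sub[].
apply: (packable_hom (f := id)) (Pdel _ _ xy) => [? ?|//|u v E'uv]; first exact: in_setT.
have [Euv _ _] := sub _ _ E'uv.
rewrite /del_edge Euv /=; apply/andP; split; apply/eqP=> -[ux vy]; move: nxy.
  by rewrite -ux -vy E'uv.
by rewrite -ux -vy E's E'uv.
Qed.

Lemma critical4_sub E V E' : critical4 E -> is_proper_subgraph E V E' ->
  packable V E' 3.
Proof. by move=> [_ cr] /cr[k [k4 [Pk _]]]; apply: packable_mono Pk. Qed.

Lemma critical4_unpackable E : critical4 E -> ~ packable setT E 3.
Proof. by case=> [[_ N] _]; apply: N. Qed.

Lemma critical4_del E x y : symmetric E -> critical4 E -> E x y ->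
  packable setT (del_edge E x y) 3.
Proof.
move=> Es cr xy; apply: critical4_sub cr _; split.
  by split; [exact: del_edge_sym | move=> u v /and3P[]; rewrite !inE].
by right; exists x, y; rewrite xy /del_edge eqxx andbF.
Qed.

Definition induced V E : rel T := fun u v => [&& E u v, u \in V & v \in V].

Lemma critical4_induced E V x : symmetric E -> critical4 E -> x \notin V ->
  packable V (induced V E) 3.
Proof.
move=> Es cr xV; apply: critical4_sub cr _; split.
  split=> [u v|u v /and3P[]//]; rewrite /induced Es.
  by rewrite [(u \in V) && _]andbC.
by left; apply: contraNneq xV => ->; rewrite inE.
Qed.

Lemma reach_le_walk1 E u v : E u v -> reach_le E 1 u v.
Proof. by move=> uv /=; apply/orP; right; apply/existsP; exists u; rewrite eqxx. Qed.

Lemma reach_le1 E u v : reach_le E 1 u v -> u = v \/ E u v.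
Proof. by case/orP=> [/eqP|/existsP[w /andP[/eqP<-]]]; [left|right]. Qed.

Lemma reach_le_walkS E k u v w : reach_le E k u v -> E v w -> reach_le E k.+1 u w.
Proof. by move=> uv vw /=; apply/orP; right; apply/existsP; exists v; rewrite uv. Qed.

Lemma reach_le_mono E j k u v : j <= k -> reach_le E j u v -> reach_le E k u v.
Proof.
move=> /subnKC<-; elim: (k - j) => [|d IHd] uv; rewrite ?addn0 // addnS /=.
by rewrite IHd.
Qed.

(** * Local constraints on colourings with three colours *)

Section ThreePacking.

Variables (V : {set T}) (E : rel T) (c : T -> nat).
Hypothesis (Es : symmetric E) (Pc : packing_coloring V E 3 c).

Lemma packing_separated k u v : u \in V -> v \in V -> u != v ->
  reach_le E k u v -> c u = c v -> c u < k.
Proof.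
move=> uV vV uv ruv cuv; rewrite ltnNge; apply/negP=> /reach_le_mono /(_ ruv).
by apply/negP; apply: (Pc.2).
Qed.

Lemma packing_range u : u \in V -> 1 <= c u <= 3.
Proof. exact: Pc.1. Qed.

(* Three neighbours of a vertex coloured 1 are pairwise at distance 2, hence
   would need three distinct colours in {2, 3}. *)
Lemma color_deg3 v x y z : v \in V -> x \in V -> y \in V -> z \in V ->
  E v x -> E v y -> E v z -> uniq [:: v; x; y; z] -> c v != 1.
Proof.
move=> vV xV yV zV vx vy vz; rewrite /= !inE !negb_or.
case/and4P=> /and3P[nvx nvy nvz] /andP[nxy nxz] nyz _.
have r2 a b : E v a -> E v b -> reach_le E 2 a b.
  by move=> va vb; apply: reach_le_walkS vb; apply: reach_le_walk1; rewrite Es.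
have := packing_separated xV yV nxy (r2 _ _ vx vy).
have := packing_separated xV zV nxz (r2 _ _ vx vz).
have := packing_separated yV zV nyz (r2 _ _ vy vz).
have := packing_separated vV xV nvx (reach_le_walk1 vx).
have := packing_separated vV yV nvy (reach_le_walk1 vy).
have := packing_separated vV zV nvz (reach_le_walk1 vz).
have := packing_range xV; have := packing_range yV; have := packing_range zV.
lia.
Qed.

(* A pair "2, 3" on a walk cannot be preceded by two more vertices: the first
   one before it must be 1, and the second one then has no colour left. *)
Lemma color_walk4 a b x y : a \in V -> b \in V -> x \in V -> y \in V ->
  uniq [:: a; b; x; y] -> E a b -> E b x -> E x y -> ~ (c x = 2 /\ c y = 3).
Proof.
move=> aV bV xV yV; rewrite /= !inE !negb_or.
case/and4P=> /and3P[nab nax nay] /andP[nbx nby] nxy _ ab bx xy [cx cy].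
have ra := reach_le_walk1 ab; have rb := reach_le_walk1 bx.
have := packing_separated aV bV nab ra.
have := packing_separated bV xV nbx rb.
have := packing_separated bV yV nby (reach_le_walkS rb xy).
have := packing_separated aV xV nax (reach_le_walkS ra bx).
have := packing_separated aV yV nay (reach_le_walkS (reach_le_walkS ra bx) xy).
have := packing_range aV; have := packing_range bV.
lia.
Qed.

Section Walk.

Variables (p : nat -> T) (m : nat).
Hypothesis pV : forall i, i <= m + 4 -> p i \in V.
Hypothesis pE : forall i, i < m + 4 -> E (p i) (p i.+1).
Hypothesis p_uniq : forall i, i + 3 <= m + 4 ->
  uniq [:: p i; p i.+1; p i.+2; p i.+3].

(** Adjacent vertices are not both 1. If neither is, they carry 2 and 3, and [color_walk4] from the
    left or from the right excludes either order. Only four consecutive vertices must be distinct,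
    so the walk may wind around a cycle. *)
Lemma color_walk_step i : i < m ->
  (c (p i.+2) == 1) = (c (p i.+3) != 1).
Proof.
move=> im.
have xV : p i.+2 \in V by apply: pV; lia.
have yV : p i.+3 \in V by apply: pV; lia.
have xy : E (p i.+2) (p i.+3) by apply: pE; lia.
have := @p_uniq i ltac:(lia) => ul; have := @p_uniq i.+2 ltac:(lia) => ur.
have nxy : p i.+2 != p i.+3 by move: ul; rewrite /= !inE; case/and4P.
have := packing_separated xV yV nxy (reach_le_walk1 xy).
have L : ~ (c (p i.+2) = 2 /\ c (p i.+3) = 3).
  by apply: color_walk4 ul _ _ _ => //; (apply: pV || apply: pE); lia.
have R : ~ (c (p i.+3) = 2 /\ c (p i.+2) = 3).
  apply: (@color_walk4 (p i.+4.+1) (p i.+4)) => //; try by apply: pV; lia.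
  - by rewrite -rev_uniq.
  - by rewrite Es; apply: pE; lia.
  - by rewrite Es; apply: pE; lia.
  - by rewrite Es.
have := packing_range xV; have := packing_range yV.
lia.
Qed.

Lemma color_walk_alternates i : c (p 2) != 1 -> i <= m ->
  (c (p i.+2) != 1) = ~~ odd i.
Proof.
move=> c0; elim: i => [|i IHi] // im /=.
by rewrite -color_walk_step // -IHi ?negbK // ltnW.
Qed.

End Walk.

End ThreePacking.

End Packing.

(* The cycle of a member of class C, read as an n-periodic walk, so that
   rotating the cycle is just shifting the argument of p. *)
Record unicyclic (T : finType) (e : rel T) (n : nat) (p : nat -> T) : Prop :=
  Unicyclic {
    uc_size : 3 <= n;
    uc_eq : forall i j, (p i == p j) = (i == j %[mod n]);
    uc_edge : forall i j,
      e (p i) (p j) = (i.+1 == j %[mod n]) || (j.+1 == i %[mod n]);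
    uc_leaf : forall x,
      (exists i, x = p i) \/ (exists i, forall y, e x y = (y == p i)) }.

Lemma eqn_mod_small n i j : i < n -> j < n -> (i == j %[mod n]) = (i == j).
Proof. by move=> i_n j_n; rewrite !modn_small. Qed.

Lemma unicyclic_of_class (T : finType) (e : rel T) :
  symmetric e -> in_class_C e -> exists n p, unicyclic e n p.
Proof.
move=> es [s [[s3 us cyc chord] [noE leaf]]].
case: s s3 us cyc chord noE leaf => [//|x0 s'] s3 us cyc chord noE leaf.
set s := x0 :: s' in s3 us cyc chord noE leaf *.
set n := size s in s3; have n0 : 0 < n by [].
pose p i := nth x0 s (i %% n).
have sp i : p i \in s by rewrite mem_nth // ltn_mod.
have pP x : x \in s -> exists i, x = p i.
  by move=> xs; exists (index x s); rewrite /p modn_small ?index_mem ?nth_index.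
have peq i j : (p i == p j) = (i == j %[mod n]).
  by rewrite /p nth_uniq ?ltn_mod.
have nextp i : next s (p i) = p i.+1.
  rewrite next_nth sp; change (nth x0 s' (index (p i) s) = p i.+1).
  rewrite /p index_uniq ?ltn_mod // -[i.+1]addn1 -modnDml addn1.
  have: i %% n < n by rewrite ltn_mod.
  rewrite leq_eqVlt => /predU1P[eq|lt]; last by rewrite (modn_small lt).
  have nE : n = (size s').+1 by [].
  (* At the last index [nth] falls back to its default [x0], the very vertex that closes the
     cycle. *)
  by rewrite eq modnn nth_default //; lia.
exists n, p; split=> // [i j|x].
  apply/idP/orP => [|[]/eqP ij].
  - by case/chord=> // /eqP; rewrite nextp peq => /eqP->; rewrite eqxx; [left|right].
  - have <- : p i.+1 = p j by apply/eqP; rewrite peq ij.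
    by rewrite -nextp; apply: next_cycle.
  - have <- : p j.+1 = p i by apply/eqP; rewrite peq ij.
    by rewrite es -nextp; apply: next_cycle.
have [/pP|xs] := boolP (x \in s); [by left | right].
have /eqP/cards1P[z zP] := leaf x xs.
have ez y : e x y = (y == z) by have := in_set1 y z; rewrite -zP inE.
have [i zi] : exists i, z = p i.
  apply: pP; apply/negPn/negP=> zs.
  by have := noE x z xs zs; rewrite ez eqxx.
by exists i => y; rewrite ez zi.
Qed.

Lemma isomorphic_of_seq (T : finType) (e : rel T) (n : nat) (t : seq T)
    (e' : rel 'I_n) :
  uniq t -> size t = n -> (forall x, x \in t) ->
  (forall x0 (i j : 'I_n), e' i j = e (nth x0 t i) (nth x0 t j)) ->
  isomorphic e e'.
Proof.
move=> ut st tT te.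
have idx x : index x t < n by rewrite -st index_mem.
pose f x := Ordinal (idx x).
have fI : injective f by move=> x y [/index_inj]; apply.
exists f; split=> [|x y]; last by rewrite (te x) !nth_index.
apply: inj_card_bij => //; rewrite card_ord -st -(card_uniqP ut).
by rewrite subset_leq_card //; apply/subsetP.
Qed.

(** * Positions and distances along the cycle *)

Section Unicyclic.

Variables (T : finType) (e : rel T) (n : nat) (p : nat -> T).
Hypothesis es : symmetric e.
Hypothesis uc : unicyclic e n p.

Let n3 : 3 <= n := uc_size uc.

Lemma unicyclic_shift a : unicyclic e n (fun i => p (i + a)).
Proof.
split=> // [i j|i j|x]; first by rewrite (uc_eq uc) eqn_modDr.
  by rewrite (uc_edge uc) -!addSn !eqn_modDr.
(* [n - a %% n] stands for -a modulo n and undoes the shift. *)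
have back i : p i = p (i + (n - a %% n) + a).
  apply/eqP; rewrite (uc_eq uc) -{1}[i]addn0 -addnA eqn_modDl mod0n.
  rewrite {2}(divn_eq a n) addnCA subnK; last by rewrite ltnW // ltn_mod; lia.
  by rewrite -mulSnr modnMl.
case: (uc_leaf uc x) => -[i xi]; [left|right]; exists (i + (n - a %% n)).
  by rewrite -back.
by move=> y; rewrite -back.
Qed.

Lemma p_neq i j : i < j < i + n -> p i != p j.
Proof.
move=> ij; rewrite (uc_eq uc) -[i in X in X != _]addn0 -[j](@subnKC i); last by lia.
by rewrite eqn_modDl eqn_mod_small; lia.
Qed.

Lemma p_uniq4 i : 4 <= n -> uniq [:: p i; p i.+1; p i.+2; p i.+3].
Proof. by move=> n4; rewrite /= !inE !negb_or !p_neq //; lia. Qed.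

Lemma p_period i : p (i + n) = p i.
Proof. by apply/eqP; rewrite (uc_eq uc) modnDr. Qed.

Lemma p_edge i : e (p i) (p i.+1).
Proof. by rewrite (uc_edge uc) eqxx. Qed.

Definition leaf_at i x := [forall y, e x y == (y == p i)].

Lemma leaf_atP i x : reflect (forall y, e x y = (y == p i)) (leaf_at i x).
Proof. exact: 'forall_eqP. Qed.

(** Having a single neighbour already puts x off the cycle: as n is at least 3, [p j] has two
    distinct neighbours, at [j.+1] and at [j + n.-1], which stands for j - 1. *)
Lemma leaf_neq i x j : leaf_at i x -> x != p j.
Proof.
move/leaf_atP=> xi; apply/eqP=> xj.
have := p_edge (j + n.-1); rewrite -addnS prednK; last by lia.
rewrite p_period es -xj xi => /eqP lj; have := p_edge j; rewrite -xj xi -lj.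
by apply/negP; apply: p_neq; lia.
Qed.

Lemma leaf_edge i x j : leaf_at i x -> e (p j) x = (p j == p i).
Proof. by move/leaf_atP=> xi; rewrite es xi. Qed.

Lemma leaf_leaf i x j y : leaf_at i x -> leaf_at j y -> e x y = false.
Proof. by move=> /leaf_atP xi /leaf_neq yj; rewrite xi (negPf (yj i)). Qed.

Lemma leaf_inj i j x y : leaf_at i x -> leaf_at j y -> p i != p j -> x != y.
Proof.
move=> /leaf_atP xi /leaf_atP yj; apply: contra_neq => xy.
by apply/eqP; rewrite -yj -xy xi.
Qed.

Lemma p_mod i : p (i %% n) = p i.
Proof. by apply/eqP; rewrite (uc_eq uc) modn_mod. Qed.

Lemma leaf_mod i x : leaf_at (i %% n) x = leaf_at i x.
Proof. by rewrite /leaf_at p_mod. Qed.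

(** Such an [f] retracts the graph onto its cycle, a leaf going to its attachment point. *)
Lemma coord_exists :
  exists f : T -> nat, forall x, f x < n /\ (x = p (f x) \/ leaf_at (f x) x).
Proof.
apply: (fin_all_exists (P := fun x fx => fx < n /\ (x = p fx \/ leaf_at fx x))) => x.
case: (uc_leaf uc x) => -[i xi]; exists (i %% n); rewrite ltn_mod.
  by split; [lia | left; rewrite p_mod].
by split; [lia | right; rewrite leaf_mod; apply/leaf_atP].
Qed.

Section Coord.

Variable f : T -> nat.
Hypothesis fP : forall x, f x < n /\ (x = p (f x) \/ leaf_at (f x) x).

Lemma coord_p i : f (p i) = i %% n.
Proof.
have [fn [/eqP|/(@leaf_neq _ _ i)]] := fP (p i); last by rewrite eqxx.
by rewrite (uc_eq uc) (modn_small fn) => /eqP.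
Qed.

Lemma coord_edge x y : e x y ->
  [|| f x == f y %[mod n], (f x).+1 == f y %[mod n] | (f y).+1 == f x %[mod n]].
Proof.
case: (fP x) (fP y) => [_ Fx] [_ Fy].
case: Fx Fy => [xE|xL] [yE|yL] exy.
- by move: exy; rewrite {1}xE {1}yE (uc_edge uc) => ->; rewrite orbT.
- by move: exy; rewrite {1}xE (leaf_edge _ yL) (uc_eq uc) => ->.
- by move: exy; rewrite {1}yE es (leaf_edge _ xL) (uc_eq uc) eq_sym => ->.
- by rewrite (leaf_leaf xL yL) in exy.
Qed.

(** Each edge moves the coordinate by at most one step around the cycle. This supplies the lower
    bounds on distances that colourings need; the disjunction records the direction without
    subtracting modulo n. *)
Lemma coord_reach k u v : reach_le e k u v ->
  exists2 d, d <= k & (f u + d == f v %[mod n]) || (f v + d == f u %[mod n]).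
Proof.
elim: k v => [|k IHk] v /=; first by move/eqP->; exists 0; rewrite ?addn0 ?eqxx.
case/orP=> [/IHk[d dk]|]; first by exists d => //; apply: leqW.
case/existsP=> w /andP[/IHk[d dk uw] /coord_edge wv].
have tr a b x y z : x + a == y %[mod n] -> y + b == z %[mod n] ->
  x + (a + b) == z %[mod n].
  by move=> /eqP xy /eqP<-; rewrite addnA -modnDml xy modnDml.
have red1 a x y z : x + a.+1 == y %[mod n] -> z.+1 == y %[mod n] -> x + a == z %[mod n].
  by move=> /eqP<-; rewrite addnS -[(x + a).+1]addn1 -[z.+1]addn1 eqn_modDr eq_sym.
case/or3P: wv => [/eqP wv|wv|wv].
- by exists d; [exact: leqW | rewrite -wv -[(f v + d) %% n]modnDml -wv modnDml].
- case/orP: uw => [uw|wu].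
    exists d.+1 => //; rewrite -[d.+1]addn1 (tr _ _ _ _ _ uw) //.
    by rewrite addn1.
  case: d dk wu => [|d] dk wu.
    exists 1 => //; rewrite addn1; apply/orP; left.
    by rewrite addn0 in wu; rewrite -addn1 -modnDml -(eqP wu) modnDml addn1.
  exists d; first by lia.
  apply/orP; right; move: wu; rewrite addnS -addSn => /eqP<-.
  by rewrite -modnDml -(eqP wv) modnDml.
- case/orP: uw => [uw|wu].
    case: d dk uw => [|d] dk uw.
      by exists 1 => //; rewrite !addn1 (eqP wv) -(eqP uw) addn0 eqxx orbT.
    by exists d; [lia | rewrite (red1 _ _ _ _ uw wv)].
  exists d.+1 => //; apply/orP; right; rewrite -addSnnS.
  by rewrite -modnDml (eqP wv) modnDml.
Qed.

End Coord.

End Unicyclic.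

Definition pattern i := nth 0 [:: 1; 2; 1; 3] (i %% 4).

Variant pattern_spec i : nat -> Prop :=
  | Pattern1 of i %% 2 = 0 : pattern_spec i 1
  | Pattern2 of i %% 4 = 1 : pattern_spec i 2
  | Pattern3 of i %% 4 = 3 : pattern_spec i 3.

Lemma patternP i : pattern_spec i (pattern i).
Proof.
have : i %% 4 < 4 by rewrite ltn_mod.
rewrite /pattern; case E: (i %% 4) => [|[|[|[|]]]] // _ /=; constructor; lia.
Qed.

Lemma pattern_range i : 1 <= pattern i <= 3.
Proof. by case: patternP. Qed.

Lemma pattern_eq i j d : pattern i = pattern j -> d <= pattern i ->
  i + d == j %[mod 4] -> d = 0 \/ pattern i = 1 /\ d = 1.
Proof.
case: (patternP i) => Hi; case: (patternP j) => Hj // _ dk /eqP; try lia.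
Qed.

(** * Colourings and obstructions around the cycle *)

Section Colorings.

Variables (T : finType) (e : rel T) (n : nat) (p : nat -> T).
Hypothesis (es : symmetric e) (ei : irreflexive e).
Hypothesis uc : unicyclic e n p.

Let n3 : 3 <= n := uc_size uc.

(** Odd positions carry 2 and 3, so every leaf may take 1. Since 4 divides n, displacements modulo n
    can be read modulo 4. *)
Lemma packable_odd_leaves : 4 %| n ->
  (forall i x, leaf_at e p i x -> odd i) -> packable setT e 3.
Proof.
move=> n4 leafodd; have [f fP] := coord_exists uc.
have step u v d : u = p (f u) -> v = p (f v) -> u != v ->
    pattern (f u) = pattern (f v) -> d <= pattern (f u) ->
    f u + d == f v %[mod n] -> pattern (f u) = 1 /\ d = 1.
  move=> uE vE uv puv dk uvd.
  have uvd4 : f u + d == f v %[mod 4].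
    by rewrite -(modn_dvdm _ n4) (eqP uvd) modn_dvdm.
  case: (pattern_eq puv dk uvd4) => // d0; case/negP: uv.
  by rewrite uE vE (uc_eq uc) -[f u]addn0 -d0.
have nbip u v : u = p (f u) -> v = p (f v) -> pattern (f u) = 1 ->
    f u + 1 == f v %[mod n] -> pattern (f v) <> 1.
  move=> uE vE pu uvd pv; have n2 : 2 %| n by apply: dvdn_trans n4.
  have : f u + 1 == f v %[mod 2] by rewrite -(modn_dvdm _ n2) (eqP uvd) modn_dvdm.
  by move: pu pv; case: patternP => // hu _; case: patternP => // hv _ /eqP; lia.
pose c x := if x == p (f x) then pattern (f x) else 1.
have cleaf x i : e x (p i) -> x != p (f x) -> c (p i) != 1.
  move=> xi xx; have [_ [/eqP|L]] := fP x; first by rewrite (negPf xx).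
  have := leafodd _ _ L; rewrite /c (coord_p es uc fP) (p_mod uc) eqxx.
  move: xi; rewrite es (leaf_edge es _ L) (uc_eq uc) => /eqP->.
  rewrite modn_small; last by case: (fP x).
  by case: patternP => //; lia.
exists c; split=> [u _|u v _ _ uv cuv]; first by rewrite /c; case: ifP; rewrite ?pattern_range.
apply/negP=> ruv; have ruv' := ruv; move: ruv' uv cuv.
have [[_ Fu] [_ Fv]] := (fP u, fP v).
case: (eqVneq u (p (f u))) => [uE|uL]; case: (eqVneq v (p (f v))) => [vE|vL].
- have cu : c u = pattern (f u) by rewrite /c -uE eqxx.
  have cv : c v = pattern (f v) by rewrite /c -vE eqxx.
  rewrite cu cv => /(coord_reach es uc fP)[d dk]; case/orP=> uvd uv cuv.
    have [p1 d1] := step _ _ _ uE vE uv cuv dk uvd.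
    by rewrite d1 in uvd; apply: (nbip _ _ uE vE p1 uvd); rewrite -cuv.
  rewrite cuv in dk; rewrite eq_sym in uv.
  have [p1 d1] := step _ _ _ vE uE uv (esym cuv) dk uvd.
  by rewrite d1 in uvd; apply: (nbip _ _ vE uE p1 uvd); rewrite cuv.
- move=> _ uv cuv; have cv : c v = 1 by rewrite /c (negPf vL).
  move: ruv; rewrite cuv cv => /reach_le1[/eqP|]; first by rewrite (negPf uv).
  by rewrite es uE => /cleaf/(_ vL); rewrite -uE cuv cv eqxx.
- move=> _ uv cuv; have cu : c u = 1 by rewrite /c (negPf uL).
  move: ruv; rewrite cu => /reach_le1[/eqP|]; first by rewrite (negPf uv).
  by rewrite vE => /cleaf/(_ uL); rewrite -vE -cuv cu eqxx.
- move=> _ uv _; move: ruv; rewrite /c (negPf uL) => /reach_le1[/eqP|].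
    by rewrite (negPf uv).
  case: Fu => [uE|Lu]; first by rewrite -uE eqxx in uL.
  case: Fv => [vE|Lv]; first by rewrite -vE eqxx in vL.
  by rewrite (leaf_leaf es uc Lu Lv).
Qed.

(** The leafless vertex and all leaves take 1, the other two cycle vertices 2 and 3. Colours 2 and 3
    occur once, so only adjacency within colour 1 is at stake. *)
Lemma packable_triangle : n = 3 -> (forall x, ~~ leaf_at e p 0 x) ->
  packable setT e 3.
Proof.
move=> nE noleaf; have [f fP] := coord_exists uc.
pose c x := if x == p 1 then 2 else if x == p 2 then 3 else 1.
exists c; split=> [u _|u v _ _ uv]; first by rewrite /c; case: ifP => // _; case: ifP.
rewrite {1 2}/c; case: (eqVneq u (p 1)) => [u1|u1].
  by case: (eqVneq v (p 1)) uv => [->|_ _]; [rewrite u1 eqxx | case: ifP].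
case: (eqVneq u (p 2)) => [u2|u2].
  case: (eqVneq v (p 1)) => // _; case: (eqVneq v (p 2)) uv => [->|//].
  by rewrite u2 eqxx.
case: (eqVneq v (p 1)) => // v1; case: (eqVneq v (p 2)) => // v2 _.
rewrite /c (negPf u1) (negPf u2); apply/negP=> /reach_le1[/eqP|].
  by rewrite (negPf uv).
have red x : x != p 1 -> x != p 2 -> x = p 0 \/ exists i, leaf_at e p i x.
  move=> x1 x2; have [fx [xE|]] := fP x; last by right; exists (f x).
  left; move: x1 x2; rewrite xE; move: (f x) fx; rewrite nE.
  by case=> [|[|[|]]]; rewrite ?eqxx.
have nl0 i x : leaf_at e p i x -> p i = p 0 -> False.
  by move=> + i0; rewrite /leaf_at i0; apply/negP/noleaf.
case: (red u u1 u2) => [->|[i Li]]; case: (red v v1 v2) => [->|[j Lj]].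
- by rewrite ei.
- by rewrite (leaf_edge es _ Lj) eq_sym => /eqP /(nl0 _ _ Lj).
- by rewrite es (leaf_edge es _ Li) eq_sym => /eqP /(nl0 _ _ Li).
- by rewrite (leaf_leaf es uc Li Lj).
Qed.

(** The single vertex coloured 4 closes the pattern at position [n.-1]. A displacement of at most 3
    past it ends at position 0 or 1, coloured 1 or 2, and has length at least 2 or 3 respectively,
    which that colour permits. *)
Lemma packable4_cycle : 4 <= n -> (forall x, exists i, x = p i) ->
  packable setT e 4.
Proof.
move=> n4 onp; have [f fP] := coord_exists uc.
have fE x : x = p (f x) by have [i ->] := onp x; rewrite (coord_p es uc fP) (p_mod uc).
have fn x : f x < n by case: (fP x).
pose c x := if f x == n.-1 then 4 else pattern (f x).
exists c; split=> [u _|u v _ _ uv cuv].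
  by rewrite /c; case: ifP => // _; case: patternP.
have step a b d : a < n.-1 -> b < n.-1 -> pattern a = pattern b ->
    d <= pattern a -> a + d == b %[mod n] -> a = b.
  move=> an bn pab dk; have p3 := pattern_range a.
  case: (ltnP (a + d) n) => adn.
    rewrite eqn_mod_small //; last by lia.
    move: pab dk; case: (patternP a) => Ha; case: (patternP b) => Hb // _; lia.
  rewrite -[a + d](subnK adn) modnDr eqn_mod_small; try lia.
  move: pab dk; case: (patternP a) => Ha; case: (patternP b) => Hb // _; lia.
apply/negP=> ruv; case/negP: uv; rewrite (fE u) (fE v); apply/eqP; congr p.
have [d dk uvd] := coord_reach es uc fP ruv.
move: cuv dk; rewrite /c.
case: eqP => [->|ul]; case: eqP => [->|vl] //; try by case: patternP.
have un := fn u; have vn := fn v => cuv dk.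
case/orP: uvd => [|vud]; first by apply: step => //; lia.
by apply/esym; apply: step vud; rewrite -?cuv //; lia.
Qed.

(** Without the closing edge, adjacent vertices have integer coordinates differing by at most 1, so
    nothing wraps around and the pattern works whatever n is modulo 4. *)
Lemma packable_path : (forall x, exists i, x = p i) ->
  packable setT (del_edge e (p n.-1) (p 0)) 3.
Proof.
move=> onp; have [f fP] := coord_exists uc.
have fE x : x = p (f x) by have [i ->] := onp x; rewrite (coord_p es uc fP) (p_mod uc).
have fn x : f x < n by case: (fP x).
set E := del_edge _ _ _.
have lip x y : E x y -> (f x <= (f y).+1) && (f y <= (f x).+1).
  move: (fE x) (fE y) (fn x) (fn y); move: (f x) (f y) => a b -> -> an bn.
  rewrite /E /del_edge !xpair_eqE !(uc_eq uc) (uc_edge uc).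
  have S i : i < n -> (i.+1 %% n == 0) && (i == n.-1) || (i.+1 %% n == i.+1).
    move=> i_n; have [e1|] := eqVneq i.+1 n; first by rewrite e1 modnn; lia.
    by move=> ne; rewrite [i.+1 %% n]modn_small; lia.
  have := S _ an; have := S _ bn; rewrite !(modn_small an) !(modn_small bn) mod0n.
  rewrite (@modn_small n.-1 n); lia.
have reach k u v : reach_le E k u v -> (f u <= f v + k) && (f v <= f u + k).
  elim: k v => [|k IHk] v /=; first by move/eqP->; lia.
  case/orP=> [/IHk|/existsP[w /andP[/IHk uw /lip]]]; lia.
exists (fun x => pattern (f x)); split=> [u _|u v _ _ uv cuv].
  exact: pattern_range.
apply/negP=> /reach; apply/negP; apply: contraNN uv => ruv.
rewrite (fE u) (fE v); apply/eqP; congr p; move: cuv ruv.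
by case: (patternP (f u)) => Hu; case: (patternP (f v)) => Hv // _; lia.
Qed.

(** Winding the walk around the cycle, alternation makes n even. The vertices not coloured 1 then
    switch between 2 and 3, and one turn of 4k + 2 steps would return with the wrong colour. *)
Lemma cycle_unpackable (V : {set T}) (E : rel T) : 4 <= n -> n %% 4 != 0 -> symmetric E ->
  (forall i, p i \in V) -> (forall i, E (p i) (p i.+1)) -> ~ packable V E 3.
Proof.
move=> n4 nmod Es pV pE [c Pc].
have [a ca] : exists a, c (p (a + 2)) != 1.
  case: (eqVneq (c (p 2)) 1) => [c2|]; last by exists 0.
  exists 1; apply: contraTneq isT => c3.
  have := packing_separated Pc (pV 2) (pV 3) _ (reach_le_walk1 (pE 2)).
  by rewrite c2 c3 (p_neq uc) //; [move/(_ isT erefl) | lia].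
pose q i := p (a + i).
have alt i : (c (q i.+2) != 1) = ~~ odd i.
  apply: (color_walk_alternates (m := i) Es Pc) => //.
  - by move=> j _; apply: pV.
  - by move=> j _; rewrite /q addnS; apply: pE.
  - by move=> j _; rewrite /q !addnS; apply: (p_uniq4 uc).
have qn i : q (i + n) = q i by rewrite /q addnA (p_period uc).
have neven : ~~ odd n by rewrite -alt -addn2 addnC qn /q.
(* A sum of 5 says that the two colours are 2 and 3 in some order. *)
have swap i : ~~ odd i -> c (q i.+4) + c (q i.+2) = 5.
  move=> oi; have := alt i; have := alt i.+2; rewrite /= negbK oi.
  have : c (q i.+2) = c (q i.+4) -> c (q i.+2) < 2.
    rewrite /q; apply: (packing_separated (k := 2) Pc (pV _) (pV _)).
      by apply: (p_neq uc); lia.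
    by rewrite !addnS; apply: (reach_le_walkS (reach_le_walk1 (pE _))).
  have := packing_range Pc (pV (a + i.+2)); have := packing_range Pc (pV (a + i.+4)).
  rewrite -/(q _) -/(q _); lia.
have four k : c (q (4 * k).+2) = c (q 2).
  elim: k => // k; have := swap (4 * k); have := swap (4 * k).+2.
  rewrite mulnS !addSn add0n /= !negbK oddM /=; lia.
have nE : n = (4 * (n %/ 4)).+2 by lia.
have := swap (4 * (n %/ 4)); rewrite oddM /= => /(_ isT).
rewrite four.
have -> : (4 * (n %/ 4)).+4 = 2 + n by lia.
rewrite qn; lia.
Qed.

(** Both attachment vertices have degree at least 3 in [E], hence avoid 1, yet alternation gives 1
    to one of two vertices at odd distance. Positions 2 and m + 2 leave the spare vertices at the
    ends. *)
Lemma odd_leaves_unpackable (V : {set T}) (E : rel T) m x y : 4 <= n -> symmetric E ->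
  (forall i, i <= m + 4 -> p i \in V) -> x \in V -> y \in V ->
  (forall i, i < m + 4 -> E (p i) (p i.+1)) -> E (p 2) x -> E (p (m + 2)) y ->
  leaf_at e p 2 x -> leaf_at e p (m + 2) y -> odd m -> ~ packable V E 3.
Proof.
move=> n4 Es pV xV yV pE px py Lx Ly om [c Pc].
have N1 j : p j != p j.+1 by apply: (p_neq uc); lia.
have N2 j : p j != p j.+2 by apply: (p_neq uc); lia.
have deg3 i z : i <= m -> z \in V -> E (p i.+2) z -> leaf_at e p i.+2 z ->
    c (p i.+2) != 1.
  move=> im zV pz Lz.
  apply: (color_deg3 (x := p i.+1) (y := p i.+3) (z := z) Es Pc) => //.
  - by apply: pV; lia.
  - by apply: pV; lia.
  - by apply: pV; lia.
  - by rewrite Es; apply: pE; lia.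
  - by apply: pE; lia.
  - have L j : (p j == z) = false.
      by rewrite eq_sym; apply: negbTE; apply: (leaf_neq es uc j Lz).
    by rewrite /= !inE !L [p i.+2 == p i.+1]eq_sym (negPf (N1 _)) (negPf (N1 _)) (negPf (N2 _)).
rewrite addn2 in py Ly.
have c2 := deg3 0 x (leq0n m) xV px Lx.
have cm := deg3 m y (leqnn m) yV py Ly.
have pu i : i + 3 <= m + 4 -> uniq [:: p i; p i.+1; p i.+2; p i.+3].
  by move=> _; apply: (p_uniq4 uc).
by have := color_walk_alternates Es Pc pV pE pu c2 (leqnn m); rewrite om cm.
Qed.

End Colorings.

(** * Obstructions on six vertices *)

Section SixVertices.

Variables (T : finType) (V : {set T}) (E : rel T).
Hypothesis Es : symmetric E.

(** The triangle vertices have degree 3, so three mutually adjacent vertices would share colours 2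
    and 3. *)
Lemma net_unpackable a b c x y z :
  uniq [:: a; b; c; x; y; z] -> {subset [:: a; b; c; x; y; z] <= V} ->
  E a b -> E b c -> E c a -> E a x -> E b y -> E c z -> ~ packable V E 3.
Proof.
move=> u6 sV ab bc ca ax bly cz [col Pc].
have [aV bV cV] : [/\ a \in V, b \in V & c \in V] by split; apply: sV; rewrite !inE eqxx ?orbT.
have [xV yV zV] : [/\ x \in V, y \in V & z \in V] by split; apply: sV; rewrite !inE eqxx ?orbT.
have nab : a != b by move: (u6); rewrite /= !inE !negb_or; case/andP=> /andP[].
have nac : a != c by move: (u6); rewrite /= !inE !negb_or; case/andP=> /and3P[].
have nbc : b != c by move: (u6); rewrite /= !inE !negb_or; case/and3P=> _ /andP[].
have ca1 : col a != 1.
  apply: (color_deg3 (x := b) (y := c) (z := x) Es Pc) => //; first by rewrite Es.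
  by move: u6; rewrite /= !inE; do !case: (_ == _) => //=.
have cb1 : col b != 1.
  apply: (color_deg3 (x := a) (y := c) (z := y) Es Pc) => //; first by rewrite Es.
  by move: u6; rewrite /= !inE (eq_sym b a); do !case: (_ == _) => //=.
have cc1 : col c != 1.
  apply: (color_deg3 (x := a) (y := b) (z := z) Es Pc) => //; first by rewrite Es.
  by move: u6; rewrite /= !inE (eq_sym c a) (eq_sym c b); do !case: (_ == _) => //=.
have := packing_separated Pc aV bV nab (reach_le_walk1 ab).
have := packing_separated Pc bV cV nbc (reach_le_walk1 bc).
have ac : E a c by rewrite Es.
have := packing_separated Pc aV cV nac (reach_le_walk1 ac).
have := packing_range Pc aV; have := packing_range Pc bV; have := packing_range Pc cV.
move: ca1 cb1 cc1; clear; lia.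
Qed.

(** Here a and b must be 2 and 3 in some order; the walks c, d, a, b and d, c, b, a exclude both
    orders by [color_walk4]. *)
Lemma c4_two_leaves_unpackable a b c d x y :
  uniq [:: a; b; c; d; x; y] -> {subset [:: a; b; c; d; x; y] <= V} ->
  E a b -> E b c -> E c d -> E d a -> E a x -> E b y -> ~ packable V E 3.
Proof.
move=> u6 sV ab bc cd da ax bly [col Pc].
have [aV bV cV] : [/\ a \in V, b \in V & c \in V] by split; apply: sV; rewrite !inE eqxx ?orbT.
have [dV xV yV] : [/\ d \in V, x \in V & y \in V] by split; apply: sV; rewrite !inE eqxx ?orbT.
have nab : a != b by move: (u6); rewrite /= !inE !negb_or; case/andP=> /andP[].
have u4 : uniq [:: a; b; c; d].
  by move: u6; rewrite /= !inE; do !case: (_ == _) => //=.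
have ca1 : col a != 1.
  apply: (color_deg3 (x := b) (y := d) (z := x) Es Pc) => //; first by rewrite Es.
  by move: u6; rewrite /= !inE; do !case: (_ == _) => //=.
have cb1 : col b != 1.
  apply: (color_deg3 (x := a) (y := c) (z := y) Es Pc) => //; first by rewrite Es.
  by move: u6; rewrite /= !inE (eq_sym b a); do !case: (_ == _) => //=.
have := color_walk4 Pc cV dV aV bV _ cd da ab.
have bda : E b a by rewrite Es.
have cb : E c b by rewrite Es.
have dc : E d c by rewrite Es.
have := color_walk4 Pc dV cV bV aV _ dc cb bda.
rewrite -[uniq [:: d; c; b; a]]rev_uniq u4 -(rot_uniq 2) /= -/(uniq [:: a; b; c; d]) u4.
have := packing_separated Pc aV bV nab (reach_le_walk1 ab).
have := packing_range Pc aV; have := packing_range Pc bV.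
move: ca1 cb1; clear; lia.
Qed.

End SixVertices.

(** * Concrete graphs checked by evaluation *)

Section EdgeList.

Variable N : nat.
Implicit Types (es : seq (nat * nat)) (col : seq nat).

Definition adj es u v := ((u, v) \in es) || ((v, u) \in es).

(* [reach_le] does not reduce: it quantifies over a locked enumeration. *)
Fixpoint reach_list es k u v : bool :=
  if k is k'.+1 then
    reach_list es k' u v
    || has (fun w => reach_list es k' u w && adj es w v) (iota 0 N)
  else u == v.

Definition packing_list es k col :=
  all (fun u => (1 <= nth 0 col u <= k) &&
    all (fun v => [|| u == v, nth 0 col u != nth 0 col v |
                      ~~ reach_list es (nth 0 col u) u v]) (iota 0 N)) (iota 0 N).

(** One direction suffices: evaluation only certifies colourings, while unpackability is argued by
    hand. *)
Lemma reach_listP es k (u v : 'I_N) :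
  reach_le (@graph_of_edges N es) k u v -> reach_list es k u v.
Proof.
elim: k v => [|k IHk] v /=; first by move/eqP->.
case/orP=> [/IHk->//|/existsP[w /andP[/IHk uw wv]]]; apply/orP; right.
by apply/hasP; exists (w : nat); rewrite ?mem_iota ?ltn_ord // uw.
Qed.

Lemma packing_listP es k col : packing_list es k col ->
  packable setT (@graph_of_edges N es) k.
Proof.
move=> /allP chk; exists (fun u : 'I_N => nth 0 col u).
have chk' (u : 'I_N) := chk u ltac:(by rewrite mem_iota ltn_ord).
split=> [u _|u v _ _ uv cuv]; first by case/andP: (chk' u).
have /andP[_ /allP/(_ v)] := chk' u; rewrite mem_iota ltn_ord => /(_ isT).
by rewrite -[val u == val v]/(u == v) (negPf uv) cuv eqxx /= -cuv; apply/contraNN/reach_listP.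
Qed.

Lemma critical4_edges es col4 cols :
  all (fun u => has (adj es u) (iota 0 N)) (iota 0 N) ->
  packing_list es 4 col4 -> ~ packable setT (@graph_of_edges N es) 3 ->
  all (fun ab => has (packing_list [seq ab' <- es | ab' != ab] 3) cols) es ->
  critical4 (@graph_of_edges N es).
Proof.
move=> /allP noiso /packing_listP P4 N3 /allP dels; apply: critical4I => //.
- by move=> u v; rewrite /graph_of_edges orbC.
- move=> u; have /hasP[v] := noiso u ltac:(by rewrite mem_iota ltn_ord).
  by rewrite mem_iota => vN uv; exists (Ordinal (vN : v < N)).
move=> x y xy.
have [ab abes abE] : exists2 ab, ab \in es & ab = (x : nat, y : nat) \/ ab = (y : nat, x : nat).
  by case/orP: xy => h; [exists (x : nat, y : nat) | exists (y : nat, x : nat)] => //; [left|right].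
have /hasP[col _ /packing_listP] := dels _ abes.
apply: (packable_hom (f := id)) => // u v /and3P[uv].
have inj (a b c d : 'I_N) : ((a, b) != (c, d)) = ((a : nat, b : nat) != (c : nat, d : nat)) by [].
rewrite !inj => n1 n2; rewrite /graph_of_edges !mem_filter.
have n3 : (v : nat, u : nat) != (x : nat, y : nat).
  by apply: contra_neq n2 => -[-> ->].
have n4 : (v : nat, u : nat) != (y : nat, x : nat).
  by apply: contra_neq n1 => -[-> ->].
by case: abE => ->; rewrite ?n1 ?n2 ?n3 ?n4.
Qed.

End EdgeList.

Lemma net_critical4 : critical4 net_graph.
Proof.
pose v i : 'I_6 := inord i.
(* The colourings follow the edge order. Without a triangle edge, its ends take 1 and their leaves,
   now at distance 4, share 3; without a leaf edge, the former neighbour takes 1. *)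
apply: (@critical4_edges _ _ [:: 2; 3; 4; 1; 1; 1]
  [:: [:: 1; 1; 2; 3; 3; 1]; [:: 2; 1; 1; 1; 3; 3]; [:: 1; 2; 1; 3; 1; 3];
      [:: 1; 2; 3; 1; 1; 1]; [:: 2; 1; 3; 1; 1; 1]; [:: 2; 3; 1; 1; 1; 1]]) => //.
apply: (@net_unpackable _ _ _ _ (v 0) (v 1) (v 2) (v 3) (v 4) (v 5));
  rewrite ?/net_graph /graph_of_edges ?inordK //.
- by move=> i j; rewrite orbC.
- by apply: (map_uniq (f := val)); rewrite /= !inordK.
- by move=> i _; rewrite inE.
Qed.

Lemma c4_two_leaves_critical4 : critical4 c4_two_leaves.
Proof.
pose v i : 'I_6 := inord i.
(* Deleting an edge at 0 or 1 lets one of these vertices, now of degree 2, take 1. Without (2,3)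
   they keep 2 and 3, and all else is 1. *)
apply: (@critical4_edges _ _ [:: 2; 3; 4; 1; 1; 1]
  [:: [:: 2; 1; 3; 1; 1; 2]; [:: 2; 1; 3; 1; 1; 3]; [:: 1; 2; 1; 3; 3; 1];
      [:: 2; 3; 1; 1; 1; 1]; [:: 1; 2; 1; 3; 1; 1]; [:: 2; 1; 3; 1; 1; 1]]) => //.
apply: (@c4_two_leaves_unpackable _ _ _ _ (v 0) (v 1) (v 2) (v 3) (v 4) (v 5));
  rewrite ?/c4_two_leaves /graph_of_edges ?inordK //.
- by move=> i j; rewrite orbC.
- by apply: (map_uniq (f := val)); rewrite /= !inordK.
- by move=> i _; rewrite inE.
Qed.

Lemma critical4_isomorphic (T T' : finType) (e : rel T) (e' : rel T') :
  isomorphic e e' -> critical4 e' -> critical4 e.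
Proof.
case=> f [[g fK gK] fe] [[P4 N4] cr].
have fI := can_inj fK; have gI := can_inj gK.
split.
  split=> [|j j4 Pj]; first by apply: (packable_hom (f := f)) P4 => [? ?|x y _ _ /fI//|x y];
    rewrite ?inE ?fe.
  apply: (N4 j j4); apply: (packable_hom (f := g)) Pj => [? ?|x y _ _ /gI//|x y];
    rewrite ?inE //.
  by rewrite -fe !gK.
move=> V E [[Es sub] prop].
pose E' : rel T' := fun x y => E (g x) (g y).
pose V' := f @: V.
have gV' x : (x \in V') = (g x \in V) by rewrite -{1}[x]gK mem_imset.
have [] := cr V' E'.
  split; first split.
  - by move=> x y; rewrite /E' Es.
  - by move=> x y /sub[]; rewrite !gV' -fe !gK.
  case: prop => [VT|[x [y /andP[xy nxy]]]]; [left|right].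
    apply: contra_neq VT => VT; apply/setP=> x; rewrite -[x]fK -gV' VT.
    by rewrite !inE.
  by exists (f x), (f y); rewrite fe xy /E' !fK.
move=> k [k4 [Pk Nk]]; exists k; split=> //; split=> [|j jk Pj].
  apply: (packable_hom (f := f)) Pk => [x xV|x y _ _ /fI//|x y].
    by rewrite gV' fK.
  by rewrite /E' !fK.
by apply: (Nk j jk); apply: (packable_hom (f := g)) Pj => [x|x y _ _ /gI|]; rewrite ?gV'.
Qed.

Lemma unicyclic_of_cycle_graph (T : finType) (e : rel T) n :
  3 <= n -> isomorphic e (@cycle_graph n) ->
  exists p, unicyclic e n p /\ (forall x, exists i, x = p i).
Proof.
move=> n3 [f [[g fK gK] fe]].
have lt i : i %% n < n by rewrite ltn_mod; lia.
pose p i := g (Ordinal (lt i)).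
have onp x : exists i, x = p i.
  exists (f x); rewrite -[x in LHS]fK /p; congr g; apply: val_inj => /=.
  by rewrite modn_small.
exists p; split=> //; split=> // [i j|i j|x]; last by left.
  by rewrite (can_eq gK).
rewrite -fe !gK /cycle_graph /= -[(i %% n).+1]addn1 -[(j %% n).+1]addn1 !modnDml !addn1.
by rewrite eq_sym [i %% n == _]eq_sym.
Qed.

(** * Critical members of the class *)

Section Critical.

Variables (T : finType) (e : rel T).
Hypothesis (es : symmetric e) (ei : irreflexive e).

Lemma cycle_critical4 n p : unicyclic e n p -> (forall x, exists i, x = p i) ->
  5 <= n -> n %% 4 != 0 -> critical4 e.
Proof.
move=> uc onp n5 nmod; apply: critical4I => //.
- by move=> x; have [i ->] := onp x; exists (p i.+1); apply: (p_edge uc).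
- by apply: (packable4_cycle es uc) => //; lia.
- apply: (cycle_unpackable uc) => //; [lia | by move=> i; exact: (p_edge uc)].
(* The shift by [i.+1] turns the deleted edge into the closing one, from position [n.-1] to 0. *)
have del i : packable setT (del_edge e (p i) (p i.+1)) 3.
  have uc' := unicyclic_shift uc i.+1.
  have onp' x : exists k, x = p (k + i.+1).
    case: (uc_leaf uc' x) => // -[k xk]; have [j xj] := onp x.
    by have /leaf_atP/(leaf_neq es uc j) := xk; rewrite xj eqxx.
  have := packable_path es uc' onp'; rewrite add0n addnS -addSn prednK; last by lia.
  by rewrite addnC (p_period uc).
move=> x y; have [i ->] := onp x; have [j ->] := onp y.
rewrite (uc_edge uc) -!(uc_eq uc) => /orP[] /eqP <-; first exact: del.
apply: (packable_hom (f := id)) (del j) => // u v.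
by rewrite /del_edge [_ && (_ != _)]andbC.
Qed.

Lemma critical4_triangle p : unicyclic e 3 p -> critical4 e ->
  isomorphic e net_graph.
Proof.
move=> uc cr.
have leaves i : exists x, leaf_at e p i x.
  have [/existsP//|/existsPn noleaf] := boolP [exists x, leaf_at e p i x].
  case: (critical4_unpackable cr).
  exact: (packable_triangle es ei (unicyclic_shift uc i)).
have [[[x Lx] [y Ly]] [z Lz]] := (leaves 0, leaves 1, leaves 2).
pose t := [:: p 0; p 1; p 2; x; y; z].
have tu : uniq t.
  have L j w k : leaf_at e p k w -> (p j == w) = false.
    by move=> Lw; rewrite eq_sym; apply: negbTE; apply: (leaf_neq es uc j Lw).
  rewrite /= !inE !(L _ _ _ Lx) !(L _ _ _ Ly) !(L _ _ _ Lz) !(uc_eq uc) /=.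
  rewrite (negPf (leaf_inj Lx Ly _)) ?(uc_eq uc) //.
  rewrite (negPf (leaf_inj Lx Lz _)) ?(uc_eq uc) //.
  by rewrite (negPf (leaf_inj Ly Lz _)) ?(uc_eq uc).
(* A vertex outside [t] would make the subgraph induced on [t] proper, hence 3-packable, although it
   contains a net. *)
have tT w : w \in t.
  apply: contraT => wt; have := critical4_induced es cr (V := [set u in t]).
  move/(_ w); rewrite inE => /(_ wt) P3; exfalso; move: P3.
  apply: (@net_unpackable _ _ _ _ (p 0) (p 1) (p 2) x y z) => //.
  - by move=> u v; rewrite /induced es [(u \in _) && _]andbC.
  - by move=> u ut; rewrite inE.
  1-6: rewrite /induced !inE !eqxx ?orbT ?andbT.
  1-6: by rewrite ?(uc_edge uc) ?(leaf_edge es _ Lx) ?(leaf_edge es _ Ly) ?(leaf_edge es _ Lz).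
apply: (@isomorphic_of_seq _ _ _ t) => // x0 [i i6] [j j6] /=.
have [/leaf_atP ex /leaf_atP ey /leaf_atP ez] := And3 Lx Ly Lz.
have [ex' ey' ez'] := And3 (fun j => leaf_edge es j Lx) (fun j => leaf_edge es j Ly)
  (fun j => leaf_edge es j Lz).
have LL := (leaf_leaf es uc Lx Ly, leaf_leaf es uc Lx Lz, leaf_leaf es uc Ly Lx,
  leaf_leaf es uc Ly Lz, leaf_leaf es uc Lz Lx, leaf_leaf es uc Lz Ly).
case: i i6 => [|[|[|[|[|[|//]]]]]] i6; case: j j6 => [|[|[|[|[|[|//]]]]]] j6 /=;
  by rewrite ?(uc_edge uc) ?LL ?ei ?ex ?ey ?ez ?ex' ?ey' ?ez' ?(uc_eq uc).
Qed.

Lemma critical4_four p x y : unicyclic e 4 p -> critical4 e ->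
  leaf_at e p 0 x -> leaf_at e p 1 y -> isomorphic e c4_two_leaves.
Proof.
move=> uc cr Lx Ly.
pose t := [:: p 0; p 1; p 2; p 3; x; y].
have tu : uniq t.
  have L j w k : leaf_at e p k w -> (p j == w) = false.
    by move=> Lw; rewrite eq_sym; apply: negbTE; apply: (leaf_neq es uc j Lw).
  rewrite /= !inE !(L _ _ _ Lx) !(L _ _ _ Ly) !(uc_eq uc) /=.
  by rewrite (negPf (leaf_inj Lx Ly _)) ?(uc_eq uc).
have tT w : w \in t.
  apply: contraT => wt; have := critical4_induced es cr (V := [set u in t]).
  move/(_ w); rewrite inE => /(_ wt) P3; exfalso; move: P3.
  apply: (@c4_two_leaves_unpackable _ _ _ _ (p 0) (p 1) (p 2) (p 3) x y) => //.
  - by move=> u v; rewrite /induced es [(u \in _) && _]andbC.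
  - by move=> u ut; rewrite inE.
  1-6: rewrite /induced !inE !eqxx ?orbT ?andbT.
  1-6: by rewrite ?(uc_edge uc) ?(leaf_edge es _ Lx) ?(leaf_edge es _ Ly).
apply: (@isomorphic_of_seq _ _ _ t) => // x0 [i i6] [j j6] /=.
have [/leaf_atP ex /leaf_atP ey] := conj Lx Ly.
have [ex' ey'] := conj (fun j => leaf_edge es j Lx) (fun j => leaf_edge es j Ly).
have LL := (leaf_leaf es uc Lx Ly, leaf_leaf es uc Ly Lx).
case: i i6 => [|[|[|[|[|[|//]]]]]] i6; case: j j6 => [|[|[|[|[|[|//]]]]]] j6 /=;
  by rewrite ?(uc_edge uc) ?LL ?ei ?ex ?ey ?ex' ?ey' ?(uc_eq uc).
Qed.

Lemma critical4_cycle n p : unicyclic e n p -> critical4 e -> 5 <= n ->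
  n %% 4 != 0 -> isomorphic e (@cycle_graph n).
Proof.
move=> uc cr n5 nmod.
have onp x : exists i, x = p i.
  case: (uc_leaf uc x) => // -[i xi].
  have xp j : p j != x.
    by rewrite eq_sym; move/leaf_atP: xi => /(leaf_neq es uc j).
  have := critical4_induced es cr (V := [set~ x]).
  move/(_ x); rewrite !inE eqxx => /(_ isT) P3; exfalso; move: P3.
  apply: (cycle_unpackable uc) => //; first by lia.
  - by move=> u v; rewrite /induced es [(u \in _) && _]andbC.
  - by move=> j; rewrite !inE xp.
  - by move=> j; rewrite /induced !inE !xp (p_edge uc).
apply: (@isomorphic_of_seq _ _ _ (map p (iota 0 n))).
- rewrite map_inj_in_uniq ?iota_uniq // => i j; rewrite !mem_iota !add0n => i_n j_n.
  by move/eqP; rewrite (uc_eq uc) eqn_mod_small // => /eqP.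
- by rewrite size_map size_iota.
- move=> x; have [i ->] := onp x; rewrite -(p_mod uc) map_f // mem_iota add0n ltn_mod.
  by lia.
move=> x0 i j; rewrite !(nth_map 0) ?size_iota // !nth_iota // !add0n (uc_edge uc).
by rewrite /cycle_graph eq_sym [i == _ :> nat]eq_sym !(@modn_small _ n (ltn_ord _)).
Qed.

(** If all leaves sat at one parity, the pattern, shifted by 1 if necessary, would colour the graph.
    As n is even, parity survives reduction modulo n, and both arcs between the two leaves are
    odd. *)
Lemma critical4_odd_leaves n p : unicyclic e n p -> critical4 e -> 4 %| n ->
  exists a m x y,
    [/\ leaf_at e p a x, leaf_at e p (a + m) y, odd m & m.*2 <= n].
Proof.
move=> uc cr n4; have n3 := uc_size uc.
have neven : ~~ odd n by rewrite -dvdn2; apply: dvdn_trans n4.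
have [i [x [Lx ei_]]] : exists i x, leaf_at e p i x /\ ~~ odd i.
  apply: NNPP => N; apply: (critical4_unpackable cr).
  apply: (packable_odd_leaves es uc n4) => i x Lx.
  by apply/negPn/negP=> oi; apply: N; exists i, x.
have [j [y [Ly oj]]] : exists j y, leaf_at e p j y /\ odd j.
  apply: NNPP => N; apply: (critical4_unpackable cr).
  apply: (packable_odd_leaves es (unicyclic_shift uc 1) n4) => k z Lz.
  by apply/negPn/negP=> ok; apply: N; exists (k + 1), z; rewrite oddD addbT.
have mododd k : odd (k %% n) = odd k by rewrite odd_mod //; exact: negbTE.
rewrite -(leaf_mod uc) in Lx; rewrite -(leaf_mod uc) in Ly.
rewrite -mododd in ei_; rewrite -mododd in oj.
have i_n : i %% n < n by rewrite ltn_mod; lia.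
have j_n : j %% n < n by rewrite ltn_mod; lia.
move: (i %% n) (j %% n) i_n j_n Lx Ly ei_ oj => {}i {}j i_n j_n Lx Ly ei_ oj.
have [d [d_n od Ld]] : exists d, [/\ d < n, odd d & leaf_at e p (i + d) y].
  case: (ltnP i j) => ij.
    by exists (j - i); rewrite subnKC; [split=> //; lia | exact: ltnW].
  exists (j + n - i); rewrite subnKC; last by lia.
  by split; try lia; rewrite -(leaf_mod uc) modnDr (leaf_mod uc).
(* Keep the shorter arc, exchanging the leaves if necessary. *)
have [d2|d2] := leqP d.*2 n; first by exists i, d, x, y.
exists (i + d), (n - d), y, x; split=> //; try lia.
rewrite -addnA subnKC; last by lia.
by rewrite -(leaf_mod uc) modnDr (leaf_mod uc).
Qed.

(* Cutting the long arc between the two leaves leaves a proper subgraph that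
   still contains two spare vertices on either side. *)
Lemma odd_leaves_not_critical n p a m x y : unicyclic e n p ->
  leaf_at e p a x -> leaf_at e p (a + m) y -> odd m -> m + 5 <= n ->
  ~ critical4 e.
Proof.
move=> uc0 Lx0 Ly0 om mn cr.
(* The first leaf moves to position 2; adding n guards against truncation when a < 2. *)
pose q i := p (i + (a + n - 2)).
have uc : unicyclic e n q := unicyclic_shift uc0 _.
have Lx : leaf_at e q 2 x.
  rewrite /leaf_at /q.
  have -> : 2 + (a + n - 2) = a + n by lia.
  by rewrite (p_period uc0).
have Ly : leaf_at e q (m + 2) y.
  rewrite /leaf_at /q.
  have -> : m + 2 + (a + n - 2) = a + m + n by lia.
  by rewrite (p_period uc0).
(* The edge just after the walk is cut; [m + 5 <= n] keeps it off the walk. *)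
have := critical4_del es cr (p_edge uc (m + 4)).
have lf i z k : leaf_at e q k z -> e (q i) z ->
    del_edge e (q (m + 4)) (q (m + 4).+1) (q i) z.
  move=> Lz iz; rewrite /del_edge iz !xpair_eqE.
  by rewrite !(negPf (leaf_neq es uc _ Lz)) !andbF.
apply: (odd_leaves_unpackable es uc _ _ _ _ _ _ _ _ Lx Ly om) => //.
- by lia.
- exact: del_edge_sym.
- move=> i im; rewrite /del_edge (p_edge uc) !xpair_eqE /=.
  rewrite (negPf (p_neq uc (i := i) (j := m + 4) _)) /=; last by lia.
  rewrite negb_and; have [im3|im3] := eqVneq i (m + 3); apply/orP.
    by left; apply: (p_neq uc); lia.
  by right; apply: (p_neq uc); lia.
- by apply: (lf _ _ _ Lx); rewrite (leaf_edge es _ Lx).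
- by apply: (lf _ _ _ Ly); rewrite (leaf_edge es _ Ly).
Qed.

End Critical.

Theorem theorem3p4 (T : finType) (e : rel T)
  (e_sym : symmetric e) (e_irr : irreflexive e) (hC : in_class_C e) :
  critical4 e <->
  [\/ (exists n : nat, [/\ 5 <= n, n %% 4 != 0 & isomorphic e (@cycle_graph n)]),
      isomorphic e net_graph
    | isomorphic e c4_two_leaves].
Proof.
split=> [cr|].
  have [n [p uc]] := unicyclic_of_class e_sym hC; have n3 := uc_size uc.
  have [n_3|n_3] := eqVneq n 3.
    by subst n; apply: Or32; apply: critical4_triangle uc cr.
  have [n4|n4] := boolP (4 %| n); last first.
    have n5 : 5 <= n by lia.
    apply: Or31; exists n; split=> //.
    exact: critical4_cycle uc cr n5 n4.
  have [a [m [x [y [Lx Ly om mn]]]]] := critical4_odd_leaves e_sym uc cr n4.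
  have [n_4|n_4] := eqVneq n 4; last first.
    (* Here n is at least 8, and an odd m with 2m at most n satisfies m + 5 <= n; for n = 8 oddness
       lowers m to 3. *)
    by case: (odd_leaves_not_critical e_sym uc Lx Ly om) => //; lia.
  subst n; have m1 : m = 1 by lia.
  rewrite m1 addnC in Ly; apply: Or33.
  exact: (critical4_four e_sym e_irr (unicyclic_shift uc a) cr Lx Ly).
case=> [[n [n5 nmod iso]]|iso|iso].
- have [p [uc onp]] := unicyclic_of_cycle_graph (ltnW (ltnW n5)) iso.
  exact: cycle_critical4 uc onp n5 nmod.
- exact: critical4_isomorphic iso net_critical4.
- exact: critical4_isomorphic iso c4_two_leaves_critical4.
Qed.
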